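(* Let $p$ and $s$ be positive integers and let $(\mathbf{A}_n)_{n\in\mathbb{N}}$ be a sequence of $p\times p$ complex matrices such that $\mathbf{A}_{n+s}=\mathbf{A}_n$ for all $n\in\mathbb{N}$; that is, the $Fib_p^\infty$ recurrence $\mathrm{x}_{n+1}=\sum_{i=0}^{+\infty}\mathbf{A}_i\mathrm{x}_{n-i}$ ($n\in\mathbb{N}$) is $s$-periodic. Let $G:U\to\mathbb{C}[[z]]^p$ be the linear map sending each initial condition $\mathbf{u}\in U$ to the generating function $G(\mathbf{u})$ of the corresponding solution of the recurrence, let $\mathcal{G}=G(U)$, and let $(\mathbf{e}_\beta)_{\beta\in\mathbb{Z}^+}$ be the standard basis of $U$. Then every generating function $G(\mathbf{u})\in\mathcal{G}$ is a rational function of $z$. Moreover, the generating functions $G(\mathbf{e}_1),\ldots,G(\mathbf{e}_{(s+1)p})$ span the complex vector space $\mathcal{G}$. Hence $\dim\mathcal{G}\leq (s+1)p$.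
   Context: $\mathbb{N}=\{0,1,2,\ldots\}$, $\mathbb{Z}^+=\{1,2,\ldots\}$, and $\mathbb{C}[[z]]$ is the ring of formal power series with complex coefficients. Recurrence. Given a positive integer $p$ and a sequence $(\mathbf{A}_n)_{n\in\mathbb{N}}$ of $p\times p$ complex matrices, the associated $Fib_p^\infty$ recurrence is $\mathrm{x}_{n+1}=\sum_{i=0}^{+\infty}\mathbf{A}_i\mathrm{x}_{n-i}$ for all $n\in\mathbb{N}$, with $\mathrm{x}_n\in\mathbb{C}^p$. It is called $s$-periodic ($s\in\mathbb{Z}^+$) if $\mathbf{A}_{n+s}=\mathbf{A}_n$ for all $n\in\mathbb{N}$. Space of initial conditions. $U=\bigoplus_{n\in\mathbb{N}}\mathbb{C}^p$ is the complex vector space of sequences $\mathbf{u}=(\mathrm{u}_0,\mathrm{u}_1,\ldots)$ with $\mathrm{u}_n\in\mathbb{C}^p$ and $\mathrm{u}_n=0$ for all but finitely many $n$. If $\mathrm{e}_1,\ldots,\mathrm{e}_p$ is the standard basis of $\mathbb{C}^p$, the standard basis $(\mathbf{e}_\beta)_{\beta\in\mathbb{Z}^+}$ of $U$ is ordered as $\mathbf{e}_1=(\mathrm{e}_1,0,0,\ldots),\ldots,\mathbf{e}_p=(\mathrm{e}_p,0,0,\ldots)$, $\mathbf{e}_{p+1}=(0,\mathrm{e}_1,0,\ldots),\ldots,\mathbf{e}_{2p}=(0,\mathrm{e}_p,0,\ldots)$, and so on; i.e. for $m\in\mathbb{N}$ and $1\le j\le p$, $\mathbf{e}_{mp+j}$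 has $\mathrm{e}_j$ in position $m$ (positions numbered from $0$) and zero elsewhere. Solutions. A solution of the recurrence is a two-sided sequence $\mathbf{v}=(\mathrm{v}_n)_{n\in\mathbb{Z}}\in\prod_{n\in\mathbb{Z}}\mathbb{C}^p$ such that $\{n\le 0:\mathrm{v}_n\ne 0\}$ is finite and $\mathrm{v}_{n+1}=\sum_{i=0}^{+\infty}\mathbf{A}_i\mathrm{v}_{n-i}$ for all $n\in\mathbb{N}$ (each sum has only finitely many nonzero terms). For each $\mathbf{u}\in U$ there is a unique solution $\Theta(\mathbf{u})=(v_n)_{n\in\mathbb{Z}}$ with $v_{-n}=\mathrm{u}_n$ for all $n\in\mathbb{N}$. Generating functions. For $\mathbf{u}\in U$ with $\Theta(\mathbf{u})=(v_n)_{n\in\mathbb{Z}}$, the generating function is $G(\mathbf{u})=\sum_{n\ge 0}v_nz^n$, regarded as the element $(G_1(\mathbf{u}),\ldots,G_p(\mathbf{u}))\in\mathbb{C}[[z]]^p$ with $G_\alpha(\mathbf{u})=\sum_{n\ge0}v_n^{(\alpha)}z^n$, where $v_n^{(\alpha)}$ is the $\alpha$-th coordinate of $v_n$. The map $G$ is $\mathbb{C}$-linear, and $\mathcal{G}=G(U)\subseteq\mathbb{C}[[z]]^p$ is called the space of generating functions of the recurrence. Saying that $G(\mathbf{u})$ is a rational function of $z$ means that each component $G_\alpha(\mathbf{u})$, $\alpha=1,\ldots,p$, is the power series expansion of a rational function, i.e. equals $P/Q$ in $\mathbb{C}[[z]]$ for some polynomials $P,Q\in\mathbb{C}[z]$ with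 $Q(0)\neq 0$. *)

(* Defs.v *)
From HB Require Import structures.
From mathcomp Require Import all_boot all_order all_algebra.
From mathcomp Require Export all_classical.
From mathcomp Require Export reals.
From mathcomp Require Export complex.

Set Implicit Arguments.
Unset Strict Implicit.
Unset Printing Implicit Defensive.

Import Order.TTheory GRing.Theory Num.Theory.

Local Open Scope classical_set_scope.
Local Open Scope ring_scope.

Section LinearSpan.
Variables (K : fieldType) (E : lmodType K).

Definition lspan n (b : 'I_n -> E) : set E :=
  [set x | exists c : 'I_n -> K, x = \sum_(i < n) c i *: b i].

Definition lin_indep n (b : 'I_n -> E) : Prop :=
  forall c : 'I_n -> K, \sum_(i < n) c i *: b i = 0 -> forall i, c i = 0.

Definition has_dim (V : set E) (d : nat) : Prop :=
  exists b : 'I_d -> E, lin_indep b /\ V = lspan b.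

End LinearSpan.

Section FormalPowerSeries.
Variable K : fieldType.

(* A power series is its coefficient sequence; K^o makes [nat -> K^o] a
   K-vector space for the pointwise operations. *)
Definition fps_mul (f g : nat -> K^o) : nat -> K^o :=
  fun n => \sum_(i < n.+1) f i * g (n - i)%N.

Definition fps_of_poly (P : {poly K}) : nat -> K^o := fun n => P`_n.

(* f = P / Q in K[[z]], where Q is a unit because Q(0) != 0. *)
Definition rational_fps (f : nat -> K^o) : Prop :=
  exists P Q : {poly K}, Q.[0] != 0 /\
    fps_mul (fps_of_poly Q) f = fps_of_poly P.

End FormalPowerSeries.

Section Recurrence.
Variables (K : fieldType) (p : nat).

Definition init_space : set (nat -> 'cV[K]_p) :=
  [set u | finite_set [set n | u n != 0]].

(* With beta >= 1, beta = m * p + (j + 1) and j : 'I_p numbered from 0, this is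
   the j-th standard vector placed in position m. *)
Definition std_basis (beta : nat) : nat -> 'cV[K]_p :=
  fun m => \col_(j < p) (beta == (m * p + j.+1)%N)%:R.

Variable A : nat -> 'M[K]_p.

(* The sum over [setT] is the library's finitely supported sum; the first clause
   makes its support finite. *)
Definition is_solution (v : int -> 'cV[K]_p) : Prop :=
  finite_set [set n : int | n <= 0 /\ v n != 0] /\
  forall n : nat,
    v (n%:Z + 1) = \sum_(i \in [set: nat]) (A i *m v (n%:Z - i%:Z)).

Definition Theta (u : nat -> 'cV[K]_p) : int -> 'cV[K]_p :=
  xget (fun=> 0) [set v | is_solution v /\ forall n : nat, v (- n%:Z) = u n].

Definition genfun (u : nat -> 'cV[K]_p) : 'I_p -> nat -> K^o :=
  fun alpha n => Theta u n%:Z alpha 0.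

Definition genspace : set ('I_p -> nat -> K^o) := genfun @` init_space.

(* [history u n k] is the term of index n - k of the solution. *)
Fixpoint history (u : nat -> 'cV[K]_p) (n : nat) : nat -> 'cV[K]_p :=
  if n is n'.+1 then
    fun k => if k is k'.+1 then history u n' k'
             else \sum_(i \in [set: nat]) (A i *m history u n' i)
  else u.

Let sol u (n : int) : 'cV[K]_p :=
  match n with Posz m => history u m 0 | Negz m => u m.+1 end.

Lemma history_shift u n k : history u (n + k) k = history u n 0.
Proof. by elim: k => [|k IH]; rewrite ?addn0 // addnS /= IH. Qed.

Lemma history_init u n k : history u n (n + k) = u k.
Proof. by elim: n => [|n IH] //=; rewrite addSn. Qed.

Let sol_opp u (n : nat) : sol u (- n%:Z) = u n.
Proof. by case: n. Qed.

Let solB u (n i : nat) : sol u (n%:Z - i%:Z) = history u n i.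
Proof.
have [le_in|/ltnW le_ni] := leqP i n.
  by rewrite subzn //= -(history_shift u (n - i) i) subnK.
have -> : n%:Z - i%:Z = - (i - n)%N%:Z by rewrite -subzn // opprB.
by rewrite sol_opp -{2}(subnKC le_ni) history_init.
Qed.

Let finite_neg (v : int -> 'cV[K]_p) (u : nat -> 'cV[K]_p) :
  (forall n : nat, v (- n%:Z) = u n) -> init_space u ->
  finite_set [set n : int | n <= 0 /\ v n != 0].
Proof.
move=> vu fu; apply: (@sub_finite_set _ _
  ((fun n : nat => - n%:Z) @` [set n | u n != 0])); last exact: finite_image.
move=> n /= [n0 vn]; exists `|n|%N; last by rewrite abszE ler0_norm ?opprK.
by rewrite -vu abszE ler0_norm ?opprK.
Qed.

Lemma solution_unique v w : is_solution v -> is_solution w ->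
  (forall n : nat, v (- n%:Z) = w (- n%:Z)) -> v = w.
Proof.
move=> [_ rv] [_ rw] e0; apply/funext.
have H (n : nat) : forall k : nat, v (n%:Z - k%:Z) = w (n%:Z - k%:Z).
  elim: n => [|n IH] k; first by rewrite !sub0r.
  have e : n.+1%:Z = n%:Z + 1 by rewrite -addn1 PoszD.
  case: k => [|k].
    rewrite subr0 e rv rw; apply: eq_fsbigr => i _; by rewrite IH.
  have -> : n.+1%:Z - k.+1%:Z = n%:Z - k%:Z.
    by rewrite !intS opprD addrACA subrr add0r.
  exact: IH.
case=> n; first by have := H n 0%N; rewrite subr0.
by rewrite NegzE e0.
Qed.

Lemma ThetaP u : init_space u ->
  is_solution (Theta u) /\ forall n : nat, Theta u (- n%:Z) = u n.
Proof.
move=> fu; apply: (@xgetI _ _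
  [set v | is_solution v /\ forall n : nat, v (- n%:Z) = u n] (sol u)).
split; last exact: sol_opp.
split=> [|n]; first exact: (@finite_neg _ u (sol_opp u)).
rewrite -PoszD addn1 /=; apply: eq_fsbigr => i _.
by rewrite solB.
Qed.

Lemma Theta_unique u v : init_space u -> is_solution v ->
  (forall n : nat, v (- n%:Z) = u n) -> Theta u = v.
Proof.
move=> /ThetaP[sT eT] sv ev; apply: solution_unique => // n.
by rewrite eT ev.
Qed.

Lemma init_spaceP u :
  init_space u <-> exists N, forall n, (N <= n)%N -> u n = 0.
Proof.
split=> [fu|[N uN]].
  have [N ubN] : exists N, forall n, u n != 0 -> (n < N)%N.
    have [s es] := (finite_seqP _).1 fu.
    exists (\max_(i <- s) i).+1 => n un; rewrite ltnS.
    have ns : n \in s by have : [set` s] n by rewrite -es.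
    exact: (@leq_bigmax_seq _ s xpredT id n).
  exists N => n Nn; apply/eqP/negP => /negP /ubN.
  by rewrite ltnNge Nn.
apply: (@sub_finite_set _ _ `I_N); last exact: finite_II.
by move=> n /= un; rewrite ltnNge; apply: contra un => /uN ->.
Qed.

Lemma init_space_linear c u w : init_space u -> init_space w ->
  init_space (fun n => c *: u n + w n).
Proof.
move=> /init_spaceP[N uN] /init_spaceP[M wM]; apply/init_spaceP.
exists (maxn N M) => n; rewrite geq_max => /andP[/uN -> /wM ->].
by rewrite scaler0 addr0.
Qed.

Lemma std_basis_init beta : init_space (std_basis beta).
Proof.
apply/init_spaceP; exists beta => n bn; apply/matrixP => j k.
rewrite !mxE ltn_eqF // addnS ltnS (leq_trans bn) //.
rewrite (leq_trans _ (leq_addr _ _)) // leq_pmulr //.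
exact: leq_ltn_trans (ltn_ord j).
Qed.

Lemma fsum_nat N (F : nat -> 'cV[K]_p) :
  (forall i, (N <= i)%N -> F i = 0) ->
  \sum_(i \in [set: nat]) F i = \sum_(i < N) F i.
Proof.
move=> F0; rewrite fsbig_ord; apply/esym/fsbig_widen => // i [_ /= /negP].
by rewrite -leqNgt => /F0.
Qed.

Lemma Theta_recE u N n : init_space u ->
  (forall i, (N <= i)%N -> u i = 0) ->
  Theta u n.+1 = \sum_(i < n + N) A i *m Theta u (n%:Z - i%:Z).
Proof.
move=> /ThetaP[[_ rT] eT] uN; have := rT n; rewrite -PoszD addn1 => ->.
apply: fsum_nat => i Ni; have le_ni : (n <= i)%N := leq_trans (leq_addr _ _) Ni.
have -> : n%:Z - i%:Z = - (i - n)%N%:Z by rewrite -subzn // opprB.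
by rewrite eT uN ?mulmx0 // leq_subRL.
Qed.

Lemma genfun_linear c u w : init_space u -> init_space w ->
  genfun (fun n => c *: u n + w n) = c *: genfun u + genfun w.
Proof.
move=> fu fw; set x := fun n => _; have fx : init_space x.
  exact: init_space_linear.
have [N [uN wN xN]] : exists N, [/\ forall i, (N <= i)%N -> u i = 0,
    forall i, (N <= i)%N -> w i = 0 & forall i, (N <= i)%N -> x i = 0].
  move: (fu) (fw) => /init_spaceP[N uN] /init_spaceP[M wM].
  exists (maxn N M); split=> i; rewrite geq_max => /andP[/uN u0 /wM w0] //.
  by rewrite /x u0 w0 scaler0 addr0.
suff H (n k : nat) :
    Theta x (n%:Z - k%:Z) = c *: Theta u (n%:Z - k%:Z) + Theta w (n%:Z - k%:Z).
  apply/funext => j; apply/funext => n.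
  by have := H n 0%N; rewrite subr0 /genfun => ->; rewrite !mxE.
elim: n k => [|n IH] k.
  by rewrite sub0r (ThetaP fx).2 (ThetaP fu).2 (ThetaP fw).2.
case: k => [|k]; last first.
  have -> : n.+1%:Z - k.+1%:Z = n%:Z - k%:Z.
    by rewrite !intS opprD addrACA subrr add0r.
  exact: IH.
rewrite subr0 (Theta_recE n fx xN) (Theta_recE n fu uN) (Theta_recE n fw wN).
rewrite scaler_sumr -big_split /=; apply: eq_bigr => i _.
by rewrite IH mulmxDr scalemxAr.
Qed.

End Recurrence.

Arguments std_basis {K p} beta.

(* Main.v *)
Require Import Defs.
From HB Require Import structures.
From mathcomp Require Import all_boot all_order all_algebra.
From mathcomp Require Import all_classical.
From mathcomp Require Import reals.
From mathcomp Require Import complex.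

(** Let [v] be the solution with initial condition [u].  Splitting the sum that
    defines [v (n+1)] into its terms of positive index and those that read
    the initial condition gives
      [v (n+1) = sum_(i < n) A_i v (n-i) + sum_j A_(n+j) u_j]
    ([Theta_split]).  The theorem rests on two consequences of the
    [s]-periodicity of [A].

    Spanning.  The initial condition acts on the future only through [u_0], as a
    term of the generating function, and through the sums [sum_j A_(n+j) u_j].
    If [u_0 = 0], moving [u] by [s] positions into the past changes neither of
    them, so it does not change the generating function ([genfun_delay]).  Hence
    [G(e_(beta + s p)) = G(e_beta)] as soon as [beta > p], and every [G(e_beta)]
    is one of the first [(s+1) p]; the dimension bound follows because every
    finite spanning family can be shrunk to a basis ([lspan_has_dim]).

    Rationality.  The terms [i >= s] in the sum for [v (n+s+1)] are the whole sum
    for [v (n+1)], so the recurrence of infinite order collapses to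
      [v (n+s+1) = sum_(i < s) A_i v (n+s-i) + v (n+1)],
    of order [s] ([Theta_periodic_rec]).  Solutions of such a recurrence are
    determined by [s] consecutive vectors, i.e. by [s p] scalars, so the first
    [s p + 1] shifts of [v] are linearly dependent
    ([matrix_rec_annihilator]).  A dependence is one scalar linear recurrence with
    constant coefficients, shared by all the coordinates of [v], and such
    sequences have rational generating functions ([rational_fps_of_rec]). *)

Set Implicit Arguments.
Unset Strict Implicit.
Unset Printing Implicit Defensive.

Import Order.TTheory GRing.Theory Num.Theory.

Local Open Scope classical_set_scope.
Local Open Scope ring_scope.

(** * Dimension of a finitely generated span *)

Section SpanDimension.
Variables (K : fieldType) (E : lmodType K).

Lemma lspan_gen n (b : 'I_n -> E) i : lspan b (b i).
Proof.
exists (fun j => (j == i)%:R); rewrite (bigD1 i) //= eqxx scale1r big1 ?addr0 //.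
by move=> j /negPf ->; rewrite scale0r.
Qed.

Lemma lspan_sum n (b : 'I_n -> E) m (c : 'I_m -> K) (x : 'I_m -> E) :
  (forall k, lspan b (x k)) -> lspan b (\sum_(k < m) c k *: x k).
Proof.
move=> bx; apply: big_ind => [|_ _ [f ->] [g ->]|k _].
- by exists (fun=> 0); rewrite big1 // => i _; rewrite scale0r.
- exists (fun i => f i + g i); rewrite -big_split /=.
  by apply: eq_bigr => i _; rewrite scalerDl.
- have [f ->] := bx k; exists (fun i => c k * f i); rewrite scaler_sumr.
  by apply: eq_bigr => i _; rewrite scalerA.
Qed.

Lemma lspan_sub n (b : 'I_n -> E) m (b' : 'I_m -> E) :
  (forall k, lspan b (b' k)) -> lspan b' `<=` lspan b.
Proof. by move=> bb' _ [c ->]; apply: lspan_sum. Qed.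

(** A vector with a nonzero coefficient in a linear relation is a combination of
    the others, so dropping it does not change the span. *)
Lemma lspan_lift n (b : 'I_n.+1 -> E) (c : 'I_n.+1 -> K) i :
  \sum_(j < n.+1) c j *: b j = 0 -> c i != 0 ->
  lspan (fun k => b (lift i k)) = lspan b.
Proof.
move=> cb0 ci; apply/seteqP; split; apply: lspan_sub => j.
  exact: lspan_gen.
have [k ->|->] := unliftP i j; first exact: (lspan_gen (fun k => b (lift i k)) k).
have -> : b i = \sum_(k < n) (- (c i)^-1 * c (lift i k)) *: b (lift i k).
  apply: (scalerI ci); rewrite scaler_sumr.
  under eq_bigr do rewrite scalerA mulrA mulrN divff // mulN1r scaleNr.
  move: cb0; rewrite (bigD1_ord i) //= => /eqP.
  by rewrite addr_eq0 sumrN => /eqP.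
by apply: lspan_sum => k; apply: (lspan_gen (fun k => b (lift i k)) k).
Qed.

(** A spanning family of least size is independent: by [lspan_lift], a relation
    would leave a smaller one. *)
Lemma lspan_has_dim n (b : 'I_n -> E) :
  exists d : nat, has_dim (lspan b) d /\ (d <= n)%N.
Proof.
pose gen m := `[< exists b' : 'I_m -> E, lspan b = lspan b' >].
have gen_n : gen n by apply/asboolP; exists b.
have [d /asboolP[b' bb'] d_min] :=
  ex_minnP (ex_intro (fun m => is_true (gen m)) n gen_n).
exists d; split; last exact: d_min.
exists b'; split=> // c cb0 i; apply/eqP/negP => /negP ci.
case: d => [|d] in b' bb' d_min c cb0 i ci *; first by case: i {ci}.
suff : gen d by move=> /d_min; rewrite ltnn.
by apply/asboolP; exists (fun k => b' (lift i k)); rewrite (lspan_lift cb0 ci).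
Qed.

End SpanDimension.

(** * Linear recurrences and rational power series *)

Section RationalSeries.
Variable K : fieldType.

(** The denominator is the reciprocal polynomial of [C]: the coefficients of its
    product with [f] are the sums of the recurrence, hence vanish from some index
    on, and its constant term is the leading coefficient of [C], which is not 0. *)
Lemma rational_fps_of_rec (f : nat -> K^o) (C : {poly K}) (N : nat) :
  C != 0 ->
  (forall m, (N <= m)%N -> \sum_(k < size C) C`_k * f (m + k)%N = 0) ->
  rational_fps f.
Proof.
move=> C0 recf; set d := (size C).-1.
have sC : size C = d.+1 by rewrite prednK // lt0n size_poly_eq0.
pose Q := \poly_(j < d.+1) C`_(d - j).
pose P := \poly_(n < N + d) fps_mul (fps_of_poly Q) f n.
exists P, Q; split.
  by rewrite horner_coef0 coef_poly /= subn0 -/(lead_coef C) lead_coef_eq0.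
apply/funext => n; rewrite /fps_of_poly coef_poly; case: ltnP => // Nn.
have le_dn : (d <= n)%N by rewrite (leq_trans _ Nn) ?leq_addl.
(* Only the indices [j <= d] contribute to the product; reversing them turns it
   into the recurrence at [n - d]. *)
rewrite /fps_mul -(subnK le_dn) -addnS addnC big_split_ord /= addrC big1 => [|i _].
  rewrite add0r (reindex_inj rev_ord_inj) /=.
  rewrite -[RHS](recf (n - d)%N) ?sC; last by rewrite leq_subRL // addnC.
  apply: eq_bigr => k _; rewrite /fps_of_poly coef_poly subSS ltnS leq_subr.
  by rewrite -addnBA ?leq_subr // !subKn -1?ltnS.
by rewrite /fps_of_poly coef_poly ltnNge leq_addr mul0r.
Qed.

Lemma matrix_rec_eq0 (p s : nat) (B : 'I_s -> 'M[K]_p) (v : nat -> 'cV[K]_p) :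
  (forall n, v (n + s)%N = \sum_(k < s) B k *m v (n + k)%N) ->
  (forall k, (k < s)%N -> v k = 0) -> forall n, v n = 0.
Proof.
move=> recv v0; elim/ltn_ind => n IH; have [/v0 //|le_sn] := ltnP n s.
rewrite -(subnK le_sn) recv big1 // => k _.
by rewrite IH ?mulmx0 // -{2}(subnK le_sn) ltn_add2l.
Qed.

(** [M] lists, for [k <= s p], the first [s] vectors of the sequence shifted by
    [k].  It has more rows than columns, which yields a relation between the rows.
    The same combination of the shifted sequences obeys the recurrence and starts
    with [s] zeros, so it vanishes identically. *)
Lemma matrix_rec_annihilator (p s : nat) (B : 'I_s -> 'M[K]_p)
    (v : nat -> 'cV[K]_p) :
  (forall n, v (n + s)%N = \sum_(k < s) B k *m v (n + k)%N) ->
  exists2 C : {poly K}, C != 0 &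
    forall n, \sum_(k < size C) C`_k *: v (n + k)%N = 0.
Proof.
move=> recv; pose d := (s * p)%N.
pose M := \matrix_(k < d.+1) mxvec (\matrix_(i < s, j < p) v (i + k)%N j 0).
have kerM : kermx M != 0.
  by rewrite kermx_eq0 -row_leq_rank -ltnNge ltnS rank_leq_col.
pose c := nz_row (kermx M).
have cM : c *m M = 0 by apply/sub_kermxP; apply: nz_row_sub.
pose C := rVpoly c.
have C0 : C != 0.
  apply: contraNneq kerM => C0.
  by rewrite -nz_row_eq0 -/c -[c]rVpolyK -/C C0 linear0.
have sumC n : \sum_(k < size C) C`_k *: v (n + k)%N
    = \sum_(k < d.+1) c 0 k *: v (n + k)%N.
  rewrite (big_ord_widen d.+1 (fun k => C`_k *: v (n + k)%N)) ?size_poly //.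
  rewrite big_mkcond; apply: eq_bigr => k _; rewrite coef_rVpoly_ord.
  case: ltnP => // /(nth_default 0); rewrite coef_rVpoly_ord => ->.
  by rewrite scale0r.
exists C => // n; rewrite sumC; move: n.
apply: (@matrix_rec_eq0 _ _ B) => [n|k k_lt].
  under [RHS]eq_bigr do rewrite mulmx_sumr.
  rewrite exchange_big; apply: eq_bigr => k _ /=.
  rewrite addnAC recv scaler_sumr; apply: eq_bigr => i _.
  by rewrite -scalemxAr addnAC.
apply/matrixP => j z; rewrite (ord1 z) mxE summxE.
have := congr1 (fun X : 'rV_d => X 0 (mxvec_index (Ordinal k_lt) j)) cM.
rewrite !mxE => e; rewrite -[RHS]e; apply: eq_bigr => i _.
by rewrite !mxE mxvecE !mxE.
Qed.

End RationalSeries.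

(** * Generating functions of a periodic recurrence *)

Section PeriodicRecurrence.
Variables (K : fieldType) (p : nat) (A : nat -> 'M[K]_p).

Lemma Theta_split u N n : init_space u -> (forall i, (N <= i)%N -> u i = 0) ->
  Theta A u n.+1 =
    \sum_(i < n) A i *m Theta A u (n - i)%N + \sum_(j < N) A (n + j)%N *m u j.
Proof.
move=> fu uN; rewrite (Theta_recE _ _ fu uN) big_split_ord /=; congr (_ + _).
  by apply: eq_bigr => i _; rewrite subzn // ltnW.
by apply: eq_bigr => j _; rewrite PoszD opprD addNKr (ThetaP A fu).2.
Qed.

(** Both conclusions are proved by one induction, since linearity of [genfun] is
    only available on [init_space]. *)
Lemma genfun_sum m (c : 'I_m -> K) (x : 'I_m -> nat -> 'cV[K]_p) :
  (forall k, init_space (x k)) ->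
  init_space (fun n => \sum_(k < m) c k *: x k n) /\
  genfun A (fun n => \sum_(k < m) c k *: x k n) = \sum_(k < m) c k *: genfun A (x k).
Proof.
elim: m c x => [|m IH] c x fx.
  have f0 : init_space (fun n : nat => 0 : 'cV[K]_p) by apply/init_spaceP; exists 0.
  have -> : (fun n => \sum_(k < 0) c k *: x k n) = (fun=> 0).
    by apply/funext => n; rewrite big_ord0.
  split=> //; rewrite big_ord0.
  have := genfun_linear A 1 f0 f0.
  have -> : (fun n : nat => 1 *: 0 + 0 : 'cV[K]_p) = (fun=> 0).
    by apply/funext => n; rewrite scaler0 addr0.
  by rewrite scale1r -[LHS]addr0 => /addrI.
have [] := IH (fun k => c (lift ord0 k)) (fun k => x (lift ord0 k)).
  by move=> k; apply: fx.
set y := (fun n => _) => fy ey.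
have -> : (fun n => \sum_(k < m.+1) c k *: x k n)
    = (fun n => c ord0 *: x ord0 n + y n).
  by apply/funext => n; rewrite big_ord_recl.
split; first exact: init_space_linear.
by rewrite genfun_linear // ey big_ord_recl.
Qed.

Lemma std_basis_expansion (u : nat -> 'cV[K]_p) N : (0 < p)%N ->
  (forall i, (N <= i)%N -> u i = 0) ->
  exists c : 'I_(N * p) -> K, u = fun n => \sum_(b < N * p) c b *: std_basis b.+1 n.
Proof.
move=> p_gt0 uN.
exists (fun b => u (b %/ p)%N (Ordinal (ltn_pmod b p_gt0)) 0).
apply/funext => m; apply/matrixP => j z; rewrite (ord1 z) summxE.
have [le_Nm|lt_mN] := leqP N m.
  rewrite uN // mxE big1 // => b _; rewrite !mxE addnS eqSS ltn_eqF ?mulr0 //.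
  rewrite (leq_trans (ltn_ord b)) // (leq_trans _ (leq_addr _ _)) //.
  by rewrite leq_mul2r le_Nm orbT.
have lt_b : (m * p + j < N * p)%N.
  rewrite (@leq_trans (m.+1 * p)) ?leq_mul2r ?lt_mN ?orbT //.
  by rewrite mulSn addnC ltn_add2r.
rewrite (bigD1 (Ordinal lt_b)) //= big1 => [|b b_neq].
  rewrite !mxE addr0 addnS eqxx mulr1 divnMDl // divn_small // addn0.
  by congr (u m _ 0); apply: val_inj; rewrite /= modnMDl modn_small.
by rewrite !mxE addnS eqSS -[_ == _]/(b == Ordinal lt_b) (negPf b_neq) mulr0.
Qed.

Variable s : nat.
Hypothesis A_periodic : forall n : nat, A (n + s)%N = A n.

(** In the recurrence for [Theta A u (n + s).+1], the terms of index [s + i] are,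
    by periodicity, the terms of index [i] for [Theta A u n.+1]. *)
Lemma Theta_periodic_rec u n : init_space u ->
  Theta A u (n + s).+1 =
    \sum_(i < s) A i *m Theta A u (n + s - i)%N + Theta A u n.+1.
Proof.
move=> fu; have [N uN] := (init_spaceP u).1 fu.
rewrite !(Theta_recE _ _ fu uN) addnAC addnC big_split_ord /=; congr (_ + _).
  apply: eq_bigr => i _; rewrite subzn //.
  by rewrite (leq_trans (ltnW (ltn_ord i))) ?leq_addl.
apply: eq_bigr => i _; rewrite (addnC s) A_periodic; congr (_ *m Theta _ _ _).
by rewrite !PoszD opprD addrACA subrr addr0.
Qed.

Lemma genfun_rational u alpha : (0 < s)%N -> init_space u ->
  rational_fps (genfun A u alpha).
Proof.
move=> s_gt0 fu; pose v n := Theta A u n.+1.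
pose B (k : 'I_s) := A (rev_ord k) + ((k == 0 :> nat)%:R)%:M.
(* The sequence starts at index 1, because [Theta_periodic_rec] does not reach
   back to index 0; the extra identity in [B 0] is the term [Theta A u n.+1]. *)
have recv n : v (n + s)%N = \sum_(k < s) B k *m v (n + k)%N.
  rewrite [LHS]Theta_periodic_rec //.
  under [RHS]eq_bigr do rewrite mulmxDl.
  rewrite big_split (reindex_inj rev_ord_inj); congr (_ + _).
    apply: eq_bigr => k _.
    by rewrite /v -addnBA ?leq_subr // subKn // addnS.
  rewrite (bigD1 (Ordinal s_gt0)) //= mul1mx addn0 big1 ?addr0 // => k k_neq0.
  by rewrite -[_ == _]/(k == Ordinal s_gt0) (negPf k_neq0) raddf0 mul0mx.
have [C C0 annC] := matrix_rec_annihilator recv.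
apply: (@rational_fps_of_rec _ _ C 1) => // -[//|m] _.
have := congr1 (fun X : 'cV_p => X alpha 0) (annC m).
rewrite mxE summxE => e; rewrite -[RHS]e; apply: eq_bigr => k _.
by rewrite !mxE.
Qed.

(** The delayed initial condition contributes [sum_j A_(n+s+j) u_j] to the term of
    index [n+1], which equals the contribution [sum_j A_(n+j) u_j] of [u].  The
    hypothesis [u 0 = 0] is needed because [u 0] is itself the constant term of
    [genfun A u]. *)
Lemma genfun_delay u : init_space u -> u 0 = 0 ->
  genfun A (fun n => if (n < s)%N then 0 else u (n - s)%N) = genfun A u.
Proof.
move=> fu u0; set w := fun n => _; have [N uN] := (init_spaceP u).1 fu.
have wN i : (s + N <= i)%N -> w i = 0.
  move=> le_i; rewrite /w ltnNge (leq_trans (leq_addr _ _) le_i) /= uN //.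
  by rewrite leq_subRL ?(leq_trans (leq_addr _ _) le_i).
have fw : init_space w by apply/init_spaceP; exists (s + N)%N.
suff eT n : Theta A w n%:Z = Theta A u n%:Z.
  by apply/funext => a; apply/funext => n; rewrite /genfun eT.
elim/ltn_ind: n => -[_|n IH].
  have := (ThetaP A fw).2 0%N; have := (ThetaP A fu).2 0%N; rewrite oppr0 => -> ->.
  by rewrite /w sub0n u0 if_same.
rewrite (Theta_split _ fw wN) (Theta_split _ fu uN).
rewrite big_split_ord /= [X in _ + (X + _)]big1 => [|i _]; last first.
  by rewrite /w ltn_ord mulmx0.
rewrite add0r; congr (_ + _); apply: eq_bigr => i _.
  by rewrite IH // ltnS leq_subr.
by rewrite /w ltnNge leq_addr /= addKn (addnC s) addnA A_periodic.
Qed.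

(** Adding [s * p] to the index of a basis vector delays it by one period; the
    condition [p < beta] says that its position is not 0. *)
Lemma genfun_std_basis_delay beta : (p < beta)%N ->
  genfun A (std_basis (beta + s * p)) = genfun A (std_basis beta).
Proof.
move=> lt_pb; rewrite -(@genfun_delay (std_basis beta)); last 2 first.
- exact: std_basis_init.
- apply/matrixP => j z; rewrite !mxE mul0n add0n gtn_eqF //.
  exact: leq_ltn_trans (ltn_ord j) lt_pb.
congr genfun; apply/funext => m; apply/matrixP => j z; rewrite mxE.
case: ltnP => [lt_ms|le_sm].
  rewrite mxE gtn_eqF // (@leq_ltn_trans (m.+1 * p)) //.
    by rewrite mulSn addnC leq_add2r.
  rewrite (@leq_ltn_trans (s * p)) ?leq_mul2r ?lt_ms ?orbT //.
  by rewrite -[X in (X < _)%N]add0n ltn_add2r (leq_ltn_trans _ lt_pb).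
by rewrite mxE -{1}(subnK le_sm) mulnDl addnAC eqn_add2r.
Qed.

(** Subtracting [s * p] from an index beyond [(s + 1) * p] leaves one beyond [p],
    so repeated use of [genfun_std_basis_delay] ends in the first
    [(s + 1) * p] vectors. *)
Lemma genfun_std_basis_span beta : (0 < p)%N -> (0 < s)%N ->
  lspan (fun b : 'I_((s + 1) * p) => genfun A (std_basis b.+1))
    (genfun A (std_basis beta.+1)).
Proof.
move=> p_gt0 s_gt0; elim/ltn_ind: beta => beta IH.
have [lt_b|le_b] := ltnP beta ((s + 1) * p).
  exact: (lspan_gen (fun b : 'I_((s + 1) * p) => genfun A (std_basis b.+1))
            (Ordinal lt_b)).
have le_spb : (p + s * p <= beta)%N by rewrite addnC -{2}(mul1n p) -mulnDl.
have le_sb : (s * p <= beta)%N by rewrite (leq_trans _ le_spb) ?leq_addl.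
have := @genfun_std_basis_delay (beta - s * p).+1.
rewrite ltnS leq_subRL // addnC addSn subnK // => -> //.
apply: IH; rewrite ltn_subrL muln_gt0 s_gt0 p_gt0 (leq_trans _ le_b) //.
by rewrite muln_gt0 addn1.
Qed.

Lemma genspace_span : (0 < p)%N -> (0 < s)%N ->
  genspace A = lspan (fun b : 'I_((s + 1) * p) => genfun A (std_basis b.+1)).
Proof.
move=> p_gt0 s_gt0; apply/seteqP; split=> [_ [u fu <-]|_ [c ->]].
  have [N uN] := (init_spaceP u).1 fu.
  have [c ->] := std_basis_expansion p_gt0 uN.
  rewrite (genfun_sum c _).2 => [|k]; last exact: std_basis_init.
  by apply: lspan_sum => k; apply: genfun_std_basis_span.
have [fx <-] := genfun_sum c (fun b : 'I_((s + 1) * p) => std_basis_init K p b.+1).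
by exists (fun n => \sum_(b < (s + 1) * p) c b *: std_basis b.+1 n).
Qed.

End PeriodicRecurrence.

Theorem theorem1p1 (R : realType) (p s : nat) (A : nat -> 'M[R[i]]_p)
    (p_gt0 : (0 < p)%N) (s_gt0 : (0 < s)%N)
    (A_periodic : forall n : nat, A (n + s)%N = A n) :
  [/\ forall g : 'I_p -> nat -> R[i]^o, genspace A g ->
        forall alpha : 'I_p, rational_fps (g alpha),
      genspace A = lspan (fun b : 'I_((s + 1) * p) => genfun A (std_basis b.+1))
    & exists d : nat, has_dim (genspace A) d /\ (d <= (s + 1) * p)%N].
Proof.
have span := genspace_span A_periodic p_gt0 s_gt0.
split=> //; last by rewrite span; apply: lspan_has_dim.
move=> _ [u fu <-] alpha; exact: (genfun_rational A_periodic).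
Qed.
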